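(* Suppose that $f(z)=\sum_{k=0}^\infty a_k z^k$ is analytic in $\mathbb{D}$ and $|f(z)|\le 1$ in $\mathbb{D}$. Then, with $|z|=r$, $$\sum_{k=0}^\infty |a_k|r^k+|f(z)-a_0|^2\le 1\quad\text{for } r\le\frac13,$$ and the number $1/3$ cannot be improved (it cannot be replaced by any larger number such that the inequality still holds for all such $f$).
   Context: $\mathbb{D}=\{z\in\mathbb{C}:|z|<1\}$ is the open unit disk. Throughout, $r=|z|$ with $z\in\mathbb{D}$, and the inequality is asserted for every $z$ with $|z|=r$ in the indicated range. *)

(* Defs.v *)
From Stdlib Require Import Reals.
From Coquelicot Require Export Coquelicot.

Local Open Scope R_scope.

Definition in_unit_disk (z : C) : Prop := Cmod z < 1.

(* Complex differentiability at each point of the open disk; the arguments [K]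
   and [V] are those used by [is_C_derive_unique]. *)
Definition analytic_on_disk (f : C -> C) : Prop :=
  forall z : C, in_unit_disk z ->
    ex_derive (K := C_AbsRing) (V := C_NormedModule) f z.

Definition has_power_series_on_disk (f : C -> C) (a : nat -> C) : Prop :=
  forall z : C, in_unit_disk z ->
    is_pseries (K := C_AbsRing) (V := C_NormedModule) a z (f z).

Definition bounded_by_one_on_disk (f : C -> C) : Prop :=
  forall z : C, in_unit_disk z -> Cmod (f z) <= 1.

(* The majorant series is explicitly required to converge, since [Series] has a
   default value on divergent series.  When [1 <= rho] the inequality is still
   only asserted at points of the open disk. *)
Definition bohr_inequality_up_to (rho : R) : Prop :=
  forall (f : C -> C) (a : nat -> C),
    analytic_on_disk f ->
    has_power_series_on_disk f a ->
    bounded_by_one_on_disk f ->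
    forall (z : C) (r : R),
      in_unit_disk z -> Cmod z = r -> r <= rho ->
      exists s : R,
        is_series (fun k : nat => Cmod (a k) * r ^ k) s /\
        s + Cmod (f z - a O)%C ^ 2 <= 1.

(* Main.v *)
Require Import Defs.
From Stdlib Require Import Reals Lra Lia.
From Coquelicot Require Import Coquelicot.
Local Open Scope R_scope.

(** Write [x k] for [|a k|] and [d] for [1 - x 0 ^ 2].

    The inequality is delicate near [x 0 = 1]: for the automorphism
    [(x 0 - z) / (1 - x 0 * z)] at [r = 1 / 3] the tail of the majorant series is
    [d / (3 - x 0)], and adding its square to it uses up [1 - x 0] to second order.
    One therefore needs the tail bound that is attained by the automorphisms,
    [d * r / (1 - x 0 * r)] ([majorant_large_x0]), and not only [x k <= d].

    It is obtained from sums of squares.  Multiplication by a function bounded by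
    one does not increase mean squares on circles; applied to the polynomials
    [1 + c z ^ (n + 1)], with the best constant [c], this gives
    [d * (x 1 ^ 2 + ... + x n ^ 2) + x (n + 1) ^ 2 <= d ^ 2]
    ([bounded_twisted_coefficients], [bounded_coefficients]).  No integral appears:
    means are taken over equally spaced points of a circle, where Parseval's
    identity is a finite computation for polynomials ([discrete_parseval]), and the
    function is replaced by a partial sum of its series ([coefficient_comparison]).

    Summation by parts with geometric weights ([weighted_square_sum]) and the
    inequality between arithmetic and geometric means
    ([sum_le_weighted_squares]) convert these sums of squares into the bound of the
    tail, provided that [r <= x 0]; for [x 0 <= 1 / 3] a numerical bound is enough.
    The tail dominates [|f z - a 0|] too, which leaves a polynomial inequality in
    [x 0] ([majorant_bound]).

    Conversely, for [r > 1 / 3] and [a] close to [1], the majorant series of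
    [(a - z) / (1 - a * z)] alone exceeds [1] ([bohr_radius_sharp]). *)

(** * Finite sums and elementary inequalities *)

(** The value of [sum_n] is typed in a structure over [C]; [ring] works once the
    equation is read in [C] itself. *)
Ltac C_ring := lazymatch goal with |- ?a = ?b => change (@eq C a b) end; ring.

Lemma Csum_S (u : nat -> C) (n : nat) :
  sum_n u (S n) = (sum_n u n + u (S n))%C :> C.
Proof. exact (sum_Sn u n). Qed.

Lemma Rsum_S (u : nat -> R) (n : nat) :
  sum_n u (S n) = sum_n u n + u (S n) :> R.
Proof. exact (sum_Sn u n). Qed.

Lemma Rsum_le (u v : nat -> R) (n : nat) :
  (forall k, (k <= n)%nat -> u k <= v k) -> sum_n u n <= sum_n v n.
Proof.
  induction n as [|n IH]; intros H.
  - rewrite !sum_O. now apply H.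
  - rewrite !Rsum_S. apply Rplus_le_compat; [apply IH; intros|]; apply H; lia.
Qed.

Lemma Rsum_mono (u : nat -> R) (n m : nat) :
  (forall k, 0 <= u k) -> (n <= m)%nat -> sum_n u n <= sum_n u m.
Proof.
  intros H Hnm. induction Hnm as [|m Hnm IH].
  - lra.
  - rewrite Rsum_S. specialize (H (S m)). lra.
Qed.

Lemma Rsum_scal (c : R) (u : nat -> R) (n : nat) :
  sum_n (fun k => c * u k) n = c * sum_n u n :> R.
Proof. exact (sum_n_mult_l (K := R_Ring) c u n). Qed.

Lemma Rsum_plus (u v : nat -> R) (n : nat) :
  sum_n (fun k => u k + v k) n = sum_n u n + sum_n v n :> R.
Proof. exact (sum_n_plus (G := R_AbelianGroup) u v n). Qed.

Lemma Rsum_ge_0 (u : nat -> R) (n : nat) :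
  (forall k, 0 <= u k) -> 0 <= sum_n u n.
Proof.
  intros H. apply Rle_trans with (sum_n u 0).
  - rewrite sum_O. apply H.
  - apply Rsum_mono; [exact H | lia].
Qed.

Lemma Re_sum (u : nat -> C) (n : nat) :
  Re (sum_n u n) = sum_n (fun j => Re (u j)) n.
Proof.
  induction n as [|n IH].
  - now rewrite !sum_O.
  - now rewrite Csum_S, Rsum_S, re_plus, IH.
Qed.

Lemma Csum_geom (x : C) (n : nat) :
  ((1 - x) * sum_n (fun j => x ^ j)%C n)%C = (1 - x ^ S n)%C.
Proof.
  induction n as [|n IH].
  - rewrite sum_O. simpl. ring.
  - rewrite Csum_S, Cmult_plus_distr_l, IH, (Cpow_S x (S n)). ring.
Qed.

Lemma le_of_le_plus_small (x y h : R) :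
  0 <= h -> (forall e, 0 < e <= 1 -> x <= y + e * h) -> x <= y.
Proof.
  intros Hh H. apply Rnot_lt_le. intros Hlt.
  pose (e := Rmin 1 ((x - y) / (2 * (h + 1)))).
  assert (Hq : 0 < (x - y) / (2 * (h + 1))) by (apply Rdiv_lt_0_compat; lra).
  assert (He : 0 < e <= 1).
  { split; [apply Rmin_glb_lt; lra | apply Rmin_l]. }
  specialize (H e He).
  assert (He2 : e * (2 * (h + 1)) <= x - y).
  { apply Rle_div_r; [lra | apply Rmin_r]. }
  nra.
Qed.

Lemma bernoulli_le (e : R) (k : nat) :
  0 <= e <= 1 -> 1 - INR k * e <= (1 - e) ^ k.
Proof.
  intros He. induction k as [|k IH].
  - simpl. lra.
  - rewrite S_INR. simpl. pose proof (pos_INR k).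
    apply Rle_trans with ((1 - e) * (1 - INR k * e)).
    + assert (0 <= INR k * e * e) by (repeat apply Rmult_le_pos; lra). lra.
    + apply Rmult_le_compat_l; lra.
Qed.

Lemma sum_geom_le (q : R) (n : nat) :
  0 <= q < 1 -> sum_n (fun k => q ^ k) n <= / (1 - q).
Proof.
  intros Hq.
  assert (H : (1 - q) * sum_n (fun k => q ^ k) n = 1 - q ^ S n).
  { induction n as [|n IH].
    - rewrite sum_O. simpl. ring.
    - rewrite Rsum_S, Rmult_plus_distr_l, IH. simpl. ring. }
  assert (0 <= q ^ S n) by (apply pow_le; lra).
  apply (Rmult_le_reg_l (1 - q)); [lra|]. rewrite Rinv_r by lra. lra.
Qed.

Lemma Cmod_plus_sqr (u v : C) :
  Cmod (u + v) ^ 2 = Cmod u ^ 2 + 2 * Re (u * Cconj v) + Cmod v ^ 2.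
Proof.
  rewrite !Cmod2_alt. destruct u, v. unfold Re, Im. simpl. ring.
Qed.

(** * Parseval's identity on equally spaced points of a circle *)

Definition cis (t : R) : C := (cos t, sin t).

Lemma cis_pow (t : R) (n : nat) : (cis t ^ n)%C = cis (INR n * t).
Proof.
  induction n as [|n IH].
  - simpl. unfold cis. now rewrite Rmult_0_l, cos_0, sin_0.
  - rewrite Cpow_S, IH, S_INR. unfold cis, Cmult. simpl.
    replace ((INR n + 1) * t) with (t + INR n * t) by ring.
    rewrite cos_plus, sin_plus. f_equal; ring.
Qed.

Lemma Cmod_cis (t : R) : Cmod (cis t) = 1.
Proof.
  unfold Cmod, cis. simpl fst; simpl snd.
  rewrite <- sqrt_1. f_equal.
  generalize (sin2_cos2 t). unfold Rsqr. lra.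
Qed.

Lemma cis_neq_1 (t : R) : 0 < t < 2 * PI -> cis t <> 1%C.
Proof.
  intros Ht E. apply (f_equal fst) in E. simpl in E.
  assert (0 < sin (t / 2)) by (apply sin_gt_0; lra).
  replace t with (2 * (t / 2)) in E by field.
  rewrite cos_2a_sin in E. nra.
Qed.

Definition poly_eval (b : nat -> C) (n : nat) (z : C) : C :=
  sum_n (fun k => b k * z ^ k)%C n.

Definition circle_point (s : R) (n j : nat) : C :=
  (s * cis (2 * PI / INR (S n)) ^ j)%C.

Lemma Cmod_circle_point (s : R) (n j : nat) :
  0 <= s -> Cmod (circle_point s n j) = s.
Proof.
  intros Hs. unfold circle_point.
  now rewrite Cmod_mult, Cmod_R, Rabs_pos_eq, Cmod_pow, Cmod_cis, pow1, Rmult_1_r.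
Qed.

(** With [w = cis t] the summand is a constant times the [j]-th power of
    [x = Cconj (w ^ (l - k))].  Since [0 < l - k < S n], [x] is a nontrivial
    [S n]-th root of unity, so its geometric sum vanishes. *)
Lemma circle_points_orthogonal (s : R) (n k l : nat) :
  (k < l <= n)%nat ->
  sum_n (fun j => circle_point s n j ^ k * Cconj (circle_point s n j ^ l))%C n
  = RtoC 0 :> C.
Proof.
  intros Hkl.
  pose (t := 2 * PI / INR (S n)).
  pose (x := Cconj (cis t ^ (l - k))).
  assert (HS : 0 < INR (S n)) by (apply lt_0_INR; lia).
  assert (Hx : x <> 1%C).
  { intros E. apply (f_equal Cconj) in E. unfold x in E.
    rewrite Cconj_conj, cis_pow in E.
    replace (Cconj 1) with (1 : C) in E
      by (unfold Cconj; simpl; unfold RtoC; f_equal; ring).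
    revert E. apply cis_neq_1. unfold t.
    assert (Hd : 0 < INR (l - k) < INR (S n)).
    { split; [apply lt_0_INR | apply lt_INR]; lia. }
    pose proof PI_RGT_0.
    replace (INR (l - k) * (2 * PI / INR (S n)))
      with (2 * PI * (INR (l - k) / INR (S n))) by (field; lra).
    assert (0 < INR (l - k) / INR (S n) < 1).
    { split. apply Rdiv_lt_0_compat; lra. apply Rlt_div_l; lra. }
    nra. }
  assert (HxN : (x ^ S n)%C = 1%C).
  { unfold x. rewrite <- Cpow_conj, <- Cpow_mult_r, Nat.mul_comm, Cpow_mult_r.
    replace (cis t ^ S n)%C with (1 : C).
    - rewrite Cpow_1_l. unfold Cconj; simpl; unfold RtoC; f_equal; ring.
    - rewrite cis_pow. unfold t, cis.
      replace (INR (S n) * (2 * PI / INR (S n))) with (2 * PI) by (field; lra).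
      now rewrite cos_2PI, sin_2PI. }
  assert (Hsum : sum_n (fun j => x ^ j)%C n = RtoC 0 :> C).
  { generalize (Csum_geom x n). rewrite HxN. intros E.
    assert (H1 : (1 - x)%C <> 0%C).
    { intros F. apply Hx. replace x with (1 - (1 - x))%C by ring. rewrite F. C_ring. }
    replace (sum_n (fun j => x ^ j)%C n)
      with (/ (1 - x) * ((1 - x) * sum_n (fun j => x ^ j)%C n))%C
      by (field; exact H1).
    rewrite E. C_ring. }
  transitivity (RtoC s ^ (k + l) * sum_n (fun j => x ^ j)%C n)%C.
  2: rewrite Hsum; C_ring.
  rewrite <- (sum_n_mult_l (K := C_Ring)).
  apply sum_n_ext. intros j. unfold circle_point. fold t.
  assert (Hw : (cis t * Cconj (cis t))%C = 1%C).
  { rewrite <- Cmod2_conj, Cmod_cis. f_equal. ring. }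
  assert (Hs : Cconj s = s) by (unfold Cconj, RtoC; simpl; f_equal; ring).
  unfold x. change (@mult C_Ring) with Cmult.
  rewrite Cpow_conj, Cmult_conj, Hs, !Cpow_conj, !Cpow_mult_l.
  rewrite <- !Cpow_mult_r.
  replace (j * l)%nat with (j * k + (l - k) * j)%nat by nia.
  rewrite !Cpow_add_r.
  transitivity (RtoC s ^ k * RtoC s ^ l * ((cis t * Cconj (cis t)) ^ (j * k)) *
     Cconj (cis t) ^ ((l - k) * j))%C.
  - rewrite Cpow_mult_l. C_ring.
  - rewrite Hw, Cpow_1_l. C_ring.
Qed.

Lemma low_degree_orthogonal (s : R) (n m l : nat) (b : nat -> C) :
  (m < l <= n)%nat ->
  sum_n (fun j => poly_eval b m (circle_point s n j)
                  * Cconj (circle_point s n j ^ l))%C n = RtoC 0 :> C.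
Proof.
  induction m as [|m IH]; intros Hml.
  - transitivity (b O * sum_n (fun j => circle_point s n j ^ 0
                  * Cconj (circle_point s n j ^ l)) n)%C.
    + rewrite <- (sum_n_mult_l (K := C_Ring)).
      apply sum_n_ext. intros j. unfold poly_eval. rewrite sum_O.
      change (@mult C_Ring) with Cmult. simpl. C_ring.
    + rewrite circle_points_orthogonal by lia. C_ring.
  - transitivity (sum_n (fun j => poly_eval b m (circle_point s n j)
                  * Cconj (circle_point s n j ^ l)) n
      + b (S m) * sum_n (fun j => circle_point s n j ^ (S m)
                  * Cconj (circle_point s n j ^ l)) n)%C.
    + rewrite <- (sum_n_mult_l (K := C_Ring)).
      rewrite <- (sum_n_plus (G := C_AbelianGroup)).
      apply sum_n_ext. intros j. unfold poly_eval. rewrite Csum_S.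
      change (@mult C_Ring) with Cmult.
      change (@plus C_AbelianGroup) with Cplus. C_ring.
    + rewrite IH, circle_points_orthogonal by lia. C_ring.
Qed.

(** A polynomial of degree at most [n] sampled at [S n] points: no aliasing, so
    the mean of its squared modulus is exactly the weighted sum of squares of
    its coefficients.  This replaces integration over the circle. *)
Lemma discrete_parseval (s : R) (n m : nat) (b : nat -> C) :
  0 <= s -> (m <= n)%nat ->
  sum_n (fun j => Cmod (poly_eval b m (circle_point s n j)) ^ 2) n
  = INR (S n) * sum_n (fun k => Cmod (b k) ^ 2 * (s ^ k) ^ 2) m :> R.
Proof.
  intros Hs. induction m as [|m IH]; intros Hm.
  - rewrite sum_O, <- sum_n_const. apply sum_n_ext. intros j.
    unfold poly_eval. rewrite sum_O. simpl. rewrite Cmult_1_r. ring.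
  - rewrite Rsum_S, Rmult_plus_distr_l, <- IH by lia.
    transitivity (sum_n (fun j => Cmod (poly_eval b m (circle_point s n j)) ^ 2) n
      + (2 * Re (Cconj (b (S m)) * sum_n (fun j => poly_eval b m (circle_point s n j)
                  * Cconj (circle_point s n j ^ S m)) n)%C
        + INR (S n) * (Cmod (b (S m)) ^ 2 * (s ^ S m) ^ 2))).
    + rewrite <- (sum_n_mult_l (K := C_Ring)), Re_sum.
      rewrite <- (sum_n_mult_l (K := R_Ring)), <- sum_n_const.
      rewrite <- !(sum_n_plus (G := R_AbelianGroup)).
      apply sum_n_ext. intros j. unfold poly_eval. rewrite Csum_S.
      change (@mult C_Ring) with Cmult. change (@mult R_Ring) with Rmult.
      change (@plus R_AbelianGroup) with Rplus.
      rewrite Cmod_plus_sqr, Cmult_conj, Cmod_mult, Cmod_pow, Cmod_circle_point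
        by exact Hs.
      rewrite Rpow_mult_distr. rewrite <- Rplus_assoc. do 2 f_equal.
      f_equal. f_equal. ring.
    + rewrite low_degree_orthogonal by lia.
      rewrite Cmult_0_r. simpl Re. change (@eq R_AbelianMonoid) with (@eq R). ring.
Qed.

(** * Partial sums of a power series on the disk *)

Lemma poly_eval_cvg (a : nat -> C) (z l : C) :
  is_pseries (K := C_AbsRing) (V := C_NormedModule) a z l ->
  forall eps, 0 < eps ->
  exists N, forall n, (N <= n)%nat -> Cmod (poly_eval a n z - l) < eps.
Proof.
  intros H eps He.
  destruct (proj1 (filterlim_locally_ball_norm _ _) H (mkposreal eps He)) as [N HN].
  exists N. intros n Hn. specialize (HN n Hn). unfold ball_norm in HN.
  eapply Rle_lt_trans; [right | exact HN].
  apply (f_equal (fun w : C => Cmod (w - l))).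
  apply sum_n_ext. intros k. change (@scal _ C_NormedModule) with Cmult.
  apply Cmult_comm.
Qed.

(** Both the uniform approximation on circles and the final bound of
    [|f z - a 0|] come from this one estimate, the latter with [n = 0]. *)
Lemma poly_eval_increment (a : nat -> C) (z : C) (n i : nat) :
  Cmod (poly_eval a (n + i) z - poly_eval a n z)
  <= sum_n (fun k => Cmod (a k) * Cmod z ^ k) (n + i)
     - sum_n (fun k => Cmod (a k) * Cmod z ^ k) n.
Proof.
  induction i as [|i IH].
  - rewrite Nat.add_0_r. rewrite Rminus_diag.
    replace (poly_eval a n z - poly_eval a n z)%C with (0 : C) by ring.
    rewrite Cmod_0. lra.
  - rewrite Nat.add_succ_r. unfold poly_eval in *. rewrite Csum_S, Rsum_S.
    set (u := sum_n _ (n + i)) in *. set (v := sum_n _ n) in *.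
    replace (u + a (S (n + i)) * z ^ S (n + i) - v)%C
      with ((u - v) + a (S (n + i)) * z ^ S (n + i))%C by ring.
    eapply Rle_trans; [apply Cmod_triangle|].
    rewrite Cmod_mult, Cmod_pow. lra.
Qed.

(** At a radius [t] strictly between [s] and [1] the terms of the series are
    eventually at most [1], which leaves a geometric series of ratio [s / t]. *)
Lemma ex_series_Cmod_pow (g : C -> C) (b : nat -> C) (s : R) :
  has_power_series_on_disk g b -> 0 <= s < 1 ->
  ex_series (fun k => Cmod (b k) * s ^ k).
Proof.
  intros Hg Hs. pose (t := (1 + s) / 2).
  assert (Ht : s < t < 1) by (unfold t; lra).
  assert (Hconv : ex_series (K := C_AbsRing) (V := C_CompleteNormedModule)
      (fun k => scal (pow_n (RtoC t) k) (b k))).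
  { exists (g (RtoC t)). apply Hg. unfold in_unit_disk.
    rewrite Cmod_R, Rabs_pos_eq; lra. }
  destruct (Cauchy_ex_series _ Hconv (mkposreal 1 Rlt_0_1)) as [N HN].
  apply (ex_series_incr_n _ N).
  assert (Hq : 0 <= s / t < 1).
  { split. apply Rle_div_r; lra. apply Rlt_div_l; lra. }
  apply (ex_series_le (K := R_AbsRing) (V := R_CompleteNormedModule) _
    (fun k => (s / t) ^ (N + k))).
  - intros k. assert (Hk : (N <= N + k)%nat) by lia.
    specialize (HN _ _ Hk Hk). rewrite sum_n_n in HN. simpl pos in HN.
    set (m := (N + k)%nat) in *.
    change (@norm _ C_CompleteNormedModule) with Cmod in HN.
    change (@scal _ C_CompleteNormedModule) with Cmult in HN.
    change (@pow_n (AbsRing.Ring C_AbsRing)) with Cpow in HN.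
    rewrite Cmod_mult, Cmod_pow, Cmod_R, Rabs_pos_eq in HN by lra.
    assert (0 <= s ^ m) by (apply pow_le; lra).
    assert (0 < t ^ m) by (apply pow_lt; lra).
    pose proof (Cmod_ge_0 (b m)).
    change (@norm _ R_CompleteNormedModule) with Rabs.
    rewrite Rabs_pos_eq by nra.
    unfold Rdiv. rewrite Rpow_mult_distr, pow_inv.
    apply (Rmult_le_reg_r (t ^ m)); [assumption|].
    rewrite (Rmult_assoc (s ^ m)), Rinv_l by lra. nra.
  - apply -> (ex_series_incr_n (fun k => (s / t) ^ k) N).
    exists (/ (1 - s / t)). apply is_series_geom. rewrite Rabs_pos_eq; lra.
Qed.

(** The rank [N] depends on the circle only, so that a single partial sum serves
    all the sample points, whose number grows with its degree. *)
Lemma poly_eval_le_uniformly (g : C -> C) (b : nat -> C) (s eps : R) :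
  has_power_series_on_disk g b -> 0 <= s < 1 -> 0 < eps ->
  exists N, forall n z, (N <= n)%nat -> Cmod z = s ->
    Cmod (poly_eval b n z) <= Cmod (g z) + eps.
Proof.
  intros Hg Hs He.
  destruct (ex_series_Cmod_pow g b s Hg Hs) as [l Hl].
  assert (He2 : 0 < eps / 4) by lra.
  destruct (proj1 (filterlim_locally_ball_norm _ _) Hl (mkposreal _ He2)) as [N HN].
  exists N. intros n z Hn Hz.
  destruct (poly_eval_cvg b z (g z)) with (eps := eps / 2) as [M HM].
  { apply Hg. unfold in_unit_disk. lra. }
  { lra. }
  pose proof (HN n Hn) as H1.
  assert (H2 := HN (n + M)%nat ltac:(lia)).
  specialize (HM (n + M)%nat ltac:(lia)).
  pose proof (poly_eval_increment b z n M) as H3. rewrite Hz in H3.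
  pose (sg := sum_n (fun k => Cmod (b k) * s ^ k)).
  change (Rabs (sg n - l) < eps / 4) in H1.
  change (Rabs (sg (n + M)%nat - l) < eps / 4) in H2.
  fold sg in H3.
  apply Rabs_lt_between in H1. apply Rabs_lt_between in H2.
  set (u := poly_eval b n z) in *. set (v := poly_eval b (n + M) z) in *.
  replace u with (g z + ((v - g z) - (v - u)))%C by ring.
  eapply Rle_trans; [apply Cmod_triangle|].
  assert (Cmod ((v - g z) - (v - u)) <= Cmod (v - g z) + Cmod (v - u)).
  { unfold Cminus at 1. rewrite <- (Cmod_opp (v - u)). apply Cmod_triangle. }
  lra.
Qed.

Lemma Cmod_poly_eval_le (d : nat -> C) (m : nat) (z : C) :
  in_unit_disk z -> Cmod (poly_eval d m z) <= sum_n (fun k => Cmod (d k)) m.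
Proof.
  intros Hz. unfold in_unit_disk in Hz. induction m as [|m IH].
  - unfold poly_eval. rewrite !sum_O. simpl. rewrite Cmult_1_r. lra.
  - unfold poly_eval in *. rewrite Csum_S, Rsum_S.
    eapply Rle_trans; [apply Cmod_triangle|].
    apply Rplus_le_compat; [exact IH|].
    rewrite Cmod_mult, Cmod_pow.
    assert (0 <= Cmod z ^ S m <= 1).
    { pose proof (Cmod_ge_0 z). split; [now apply pow_le|].
      rewrite <- (pow1 (S m)). apply pow_incr. lra. }
    pose proof (Cmod_ge_0 (d (S m))). nra.
Qed.

(** * Mean-square comparison of coefficients *)

Lemma coefficient_comparison_inside
    (g : C -> C) (b d : nat -> C) (m n : nat) (s : R) :
  has_power_series_on_disk g b ->
  (forall z, in_unit_disk z -> Cmod (g z) <= Cmod (poly_eval d m z)) ->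
  0 <= s < 1 ->
  sum_n (fun k => Cmod (b k) ^ 2 * (s ^ k) ^ 2) n
  <= sum_n (fun k => Cmod (d k) ^ 2) m.
Proof.
  intros Hg Hgd Hs.
  pose (h := sum_n (fun k => Cmod (d k)) m).
  assert (Hh : 0 <= h) by (apply Rsum_ge_0; intros; apply Cmod_ge_0).
  apply le_of_le_plus_small with (2 * h + 1); [lra|].
  intros e He.
  destruct (poly_eval_le_uniformly g b s e Hg Hs ltac:(lra)) as [N HN].
  pose (K := (N + n + m)%nat).
  assert (HS : 0 < INR (S K)) by (apply lt_0_INR; lia).
  apply (Rmult_le_reg_l (INR (S K))); [exact HS|].
  apply Rle_trans with
    (sum_n (fun j => Cmod (poly_eval b K (circle_point s K j)) ^ 2) K).
  { rewrite discrete_parseval by (lra || lia).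
    apply Rmult_le_compat_l; [lra|]. apply Rsum_mono; [|unfold K; lia].
    intros k. apply Rmult_le_pos; apply pow2_ge_0. }
  apply Rle_trans with
    (sum_n (fun j => Cmod (poly_eval d m (circle_point s K j)) ^ 2
                     + e * (2 * h + 1)) K).
  { apply Rsum_le. intros j _.
    assert (Hz : Cmod (circle_point s K j) = s) by (apply Cmod_circle_point; lra).
    set (z := circle_point s K j) in *.
    assert (Hd : in_unit_disk z) by (unfold in_unit_disk; lra).
    assert (H1 := HN K z ltac:(unfold K; lia) Hz).
    assert (H2 := Hgd z Hd).
    assert (H3 := Cmod_poly_eval_le d m z Hd). fold h in H3.
    pose proof (Cmod_ge_0 (poly_eval b K z)).
    pose proof (Cmod_ge_0 (poly_eval d m z)).
    apply Rle_trans with ((Cmod (poly_eval d m z) + e) ^ 2).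
    - apply pow_incr. lra.
    - nra. }
  rewrite Rsum_plus, sum_n_const, discrete_parseval by (lra || (unfold K; lia)).
  rewrite <- Rmult_plus_distr_l. apply Rmult_le_compat_l; [lra|].
  apply Rplus_le_compat_r, Rsum_le. intros k _.
  assert (0 <= s ^ k <= 1).
  { split; [apply pow_le; lra|]. rewrite <- (pow1 k). apply pow_incr. lra. }
  rewrite <- (Rmult_1_r (Cmod (d k) ^ 2)) at 2.
  apply Rmult_le_compat_l; [apply pow2_ge_0 | nra].
Qed.

(** An [L2] consequence of a pointwise domination: on each circle the mean square
    of [g] is at most that of the dominating polynomial.  Parseval turns this into
    sums of squares of coefficients, and the radius then tends to [1]. *)
Lemma coefficient_comparison (g : C -> C) (b d : nat -> C) (m n : nat) :
  has_power_series_on_disk g b ->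
  (forall z, in_unit_disk z -> Cmod (g z) <= Cmod (poly_eval d m z)) ->
  sum_n (fun k => Cmod (b k) ^ 2) n <= sum_n (fun k => Cmod (d k) ^ 2) m.
Proof.
  intros Hg Hgd. pose proof (pos_INR n) as Hn.
  assert (HB : 0 <= sum_n (fun k => Cmod (b k) ^ 2) n)
    by (apply Rsum_ge_0; intros; apply pow2_ge_0).
  apply le_of_le_plus_small with (2 * INR n * sum_n (fun k => Cmod (b k) ^ 2) n).
  { apply Rmult_le_pos; lra. }
  intros e He.
  assert (H := coefficient_comparison_inside g b d m n (1 - e) Hg Hgd ltac:(lra)).
  assert ((1 - 2 * INR n * e) * sum_n (fun k => Cmod (b k) ^ 2) n
    <= sum_n (fun k => Cmod (b k) ^ 2 * ((1 - e) ^ k) ^ 2) n).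
  { rewrite <- Rsum_scal. apply Rsum_le. intros k Hk.
    rewrite <- pow_mult.
    assert (H1 := bernoulli_le e (k * 2) ltac:(lra)).
    rewrite mult_INR in H1. simpl (INR 2) in H1.
    assert (INR k * e <= INR n * e).
    { apply Rmult_le_compat_r; [lra | now apply le_INR]. }
    rewrite Rmult_comm. apply Rmult_le_compat_l; [apply pow2_ge_0 | lra]. }
  lra.
Qed.

(** * Coefficients of a function bounded by one *)

Definition one_plus_monomial (c : C) (m k : nat) : C :=
  if Nat.eqb k m then c else if Nat.eqb k 0 then RtoC 1 else RtoC 0.

Lemma sum_one_plus_monomial {G : AbelianMonoid} (c : C) (n : nat) (F : nat -> C -> G) :
  (forall k, F (S k) (RtoC 0) = zero) ->
  sum_n (fun k => F k (one_plus_monomial c (S n) k)) (S n)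
  = plus (F O (RtoC 1)) (F (S n) c).
Proof.
  intros HF. rewrite sum_Sn. f_equal.
  - assert (H : forall i, (i <= n)%nat ->
      sum_n (fun k => F k (one_plus_monomial c (S n) k)) i = F O (RtoC 1)).
    { induction i as [|i IH]; intros Hi.
      - now rewrite sum_O.
      - rewrite sum_Sn, IH by lia. unfold one_plus_monomial.
        replace (Nat.eqb (S i) (S n)) with false
          by (symmetry; apply Nat.eqb_neq; lia).
        simpl. rewrite HF. apply plus_zero_r. }
    now apply H.
  - unfold one_plus_monomial. now rewrite Nat.eqb_refl.
Qed.

(** Multiplication by [f] contracts the mean-square norm.  Here it acts on
    [1 + c z ^ (n + 1)], which [f] turns into a series whose coefficients are
    [a 0], ..., [a n], [a (n + 1) + c a 0] up to degree [n + 1]. *)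
Lemma bounded_twisted_coefficients (f : C -> C) (a : nat -> C) (c : C) (n : nat) :
  has_power_series_on_disk f a -> bounded_by_one_on_disk f ->
  sum_n (fun k => Cmod (a k) ^ 2) n + Cmod (a (S n) + c * a O) ^ 2
  <= 1 + Cmod c ^ 2.
Proof.
  intros Hf Hb.
  pose (b := fun k => (a k + c * (PS_incr_n (V := C_NormedModule) a (S n) k))%C).
  assert (Hg : has_power_series_on_disk (fun z => f z + c * (z ^ S n * f z))%C b).
  { intros z Hz.
    apply (is_pseries_plus (K := C_AbsRing) (V := C_NormedModule)); [now apply Hf|].
    apply (is_pseries_scal (K := C_AbsRing) (V := C_NormedModule)); [apply Cmult_comm|].
    apply (is_pseries_incr_n (K := C_AbsRing) (V := C_NormedModule)). now apply Hf. }
  assert (Hlow : forall k, (k <= n)%nat -> b k = a k).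
  { intros k Hk. unfold b. rewrite PS_incr_n_simplify.
    destruct (Compare_dec.le_lt_dec (S n) k); [lia|].
    change (@zero _) with (RtoC 0). ring. }
  assert (Htop : b (S n) = (a (S n) + c * a O)%C).
  { unfold b. rewrite PS_incr_n_simplify.
    destruct (Compare_dec.le_lt_dec (S n) (S n)); [|lia].
    now rewrite Nat.sub_diag. }
  assert (Hcmp := coefficient_comparison _ _ (one_plus_monomial c (S n)) (S n) (S n) Hg).
  rewrite Rsum_S, Htop in Hcmp.
  rewrite (sum_n_ext_loc (fun k => Cmod (b k) ^ 2) (fun k => Cmod (a k) ^ 2)) in Hcmp
    by (intros; now rewrite Hlow).
  rewrite (sum_one_plus_monomial c n (fun _ w => Cmod w ^ 2)) in Hcmp
    by (intros; rewrite Cmod_0; unfold zero; simpl; ring).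
  rewrite Cmod_1 in Hcmp. change (@plus R_AbelianMonoid) with Rplus in Hcmp.
  rewrite pow1 in Hcmp. apply Hcmp.
  intros z Hz. unfold poly_eval.
  rewrite (sum_one_plus_monomial c n (fun k w => (w * z ^ k)%C))
    by (intros; apply Cmult_0_l).
  change (@plus C_AbelianMonoid) with Cplus.
  replace (f z + c * (z ^ S n * f z))%C with (f z * (1 * z ^ 0 + c * z ^ S n))%C
    by (simpl; ring).
  rewrite Cmod_mult. specialize (Hb z Hz).
  pose proof (Cmod_ge_0 (1 * z ^ 0 + c * z ^ S n)). nra.
Qed.

(** This strengthens the classical [|a n| <= 1 - |a 0| ^ 2].  With
    [P n] the sum of [x k ^ 2] over [1 <= k <= n] it also reads
    [P (n + 1) <= (1 - x 0 ^ 2) ^ 2 + x 0 ^ 2 * P n], with equality at every [n] for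
    the disk automorphisms, where [x (k + 1) = (1 - x 0 ^ 2) * x 0 ^ k]. *)
Definition coefficient_condition (x : nat -> R) : Prop :=
  forall n, (1 - x O ^ 2) * (sum_n (fun k => x k ^ 2) n - x O ^ 2) + x (S n) ^ 2
    <= (1 - x O ^ 2) ^ 2.

(** The inequality is [bounded_twisted_coefficients] for the best [c]: writing
    [d = 1 - |a 0| ^ 2], the value [c = Cconj (a 0) * a (n + 1) / d] makes the last
    coefficient equal to [a (n + 1) / d].  When [|a 0| = 1], already [c = 0] forces
    all later coefficients to vanish. *)
Lemma bounded_coefficients (f : C -> C) (a : nat -> C) :
  has_power_series_on_disk f a -> bounded_by_one_on_disk f ->
  Cmod (a O) <= 1 /\ coefficient_condition (fun k => Cmod (a k)).
Proof.
  intros Hf Hb.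
  cut (forall n, Cmod (a O) <= 1 /\
    (1 - Cmod (a O) ^ 2) * (sum_n (fun k => Cmod (a k) ^ 2) n - Cmod (a O) ^ 2)
      + Cmod (a (S n)) ^ 2 <= (1 - Cmod (a O) ^ 2) ^ 2).
  { intros H. split; [apply (H O) | intros n; apply H]. }
  intros n.
  assert (H0 := bounded_twisted_coefficients f a 0 n Hf Hb).
  assert (Hs : Cmod (a O) ^ 2 <= sum_n (fun k => Cmod (a k) ^ 2) n).
  { apply Rle_trans with (sum_n (fun k => Cmod (a k) ^ 2) 0).
    - rewrite sum_O. lra.
    - apply Rsum_mono; [intros; apply pow2_ge_0 | lia]. }
  rewrite Cmult_0_l, Cplus_0_r, Cmod_0 in H0.
  pose proof (Cmod_ge_0 (a O)) as Ha. pose proof (pow2_ge_0 (Cmod (a (S n)))) as Hy.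
  assert (Ha1 : Cmod (a O) <= 1) by nra.
  split; [exact Ha1|].
  set (d := 1 - Cmod (a O) ^ 2).
  destruct (Req_dec d 0) as [Hd|Hd].
  - rewrite Hd. unfold d in Hd. nra.
  - assert (Hd' : 0 < d) by (unfold d in *; nra).
    assert (Hdc : RtoC d <> 0%C) by (intros E; apply Hd; now injection E).
    assert (H := bounded_twisted_coefficients f a (Cconj (a O) * a (S n) / d) n Hf Hb).
    assert (E : (a (S n) + Cconj (a O) * a (S n) / d * a O)%C = (a (S n) / d)%C).
    { assert (E : (a O * Cconj (a O))%C = (1 - d)%C).
      { rewrite <- Cmod2_conj, <- RtoC_minus. f_equal. unfold d. ring. }
      transitivity (a (S n) * (d + a O * Cconj (a O)) / d)%C.
      - field. exact Hdc.
      - rewrite E. field. exact Hdc. }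
    rewrite E in H.
    rewrite !Cmod_div, Cmod_mult, Cmod_conj, Cmod_R, Rabs_pos_eq in H
      by (exact Hdc || lra).
    set (y := Cmod (a (S n))) in *. set (P := sum_n _ n) in *.
    set (x := Cmod (a O)) in *.
    assert (Hyd : y ^ 2 = d * (d * (y / d) ^ 2)) by (field; exact Hd).
    assert (Hxd : (x * y / d) ^ 2 = x ^ 2 * (y / d) ^ 2) by (field; exact Hd).
    rewrite Hxd in H. rewrite Hyd.
    assert (Hx2 : x ^ 2 = 1 - d) by (unfold d; ring).
    rewrite Hx2 in *. nra.
Qed.

(** * From sums of squares to the majorant series *)

(** Summation by parts of the recursive form of [coefficient_condition] against
    the nonincreasing weights [rho ^ k]. *)
Lemma weighted_square_sum (x : nat -> R) (rho : R) :
  0 <= rho <= 1 ->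
  coefficient_condition x ->
  forall n, (1 - x O ^ 2 * rho) * (sum_n (fun k => x k ^ 2 * rho ^ k) n - x O ^ 2)
    <= rho * (1 - x O ^ 2) ^ 2.
Proof.
  intros Hr H n. unfold coefficient_condition in H. set (d := 1 - x O ^ 2) in *.
  (* The slack of the hypothesis; it satisfies
     [gap (k + 1) - gap k = x 0 ^ 2 * x (k + 1) ^ 2 - x (k + 2) ^ 2], so by
     induction [rho ^ (k + 1) * gap k] is at most the slack of the recursive form of
     the weighted inequality. *)
  pose (gap := fun n => d ^ 2 - d * (sum_n (fun k => x k ^ 2) n - x O ^ 2)
                        - x (S n) ^ 2).
  pose (M := sum_n (fun k => x k ^ 2 * rho ^ k)).
  assert (Hgap : forall n, 0 <= gap n).
  { intros k. unfold gap. specialize (H k). lra. }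
  assert (Hrec : forall m, rho ^ S m * gap m
      <= rho * d ^ 2 + x O ^ 2 * rho * (M m - x O ^ 2) - (M (S m) - x O ^ 2)).
  { induction m as [|k IH].
    - unfold gap, M. rewrite Rsum_S, !sum_O. simpl. lra.
    - assert (E : gap (S k) = gap k + x O ^ 2 * x (S k) ^ 2 - x (S (S k)) ^ 2).
      { unfold gap. rewrite Rsum_S. unfold d. ring. }
      assert (H1 : rho ^ S (S k) * gap k <= rho ^ S k * gap k).
      { assert (0 <= rho ^ S k * gap k).
        { apply Rmult_le_pos; [apply pow_le; lra | apply Hgap]. }
        change (rho ^ S (S k)) with (rho * rho ^ S k). nra. }
      assert (E1 : M (S (S k)) = M (S k) + x (S (S k)) ^ 2 * rho ^ S (S k))
        by apply Rsum_S.
      assert (E2 : M (S k) = M k + x (S k) ^ 2 * rho ^ S k) by apply Rsum_S.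
      rewrite E, E1.
      replace (M (S k) - x O ^ 2) with (M k - x O ^ 2 + x (S k) ^ 2 * rho ^ S k)
        by (rewrite E2; ring).
      rewrite E2 in IH |- *.
      change (rho ^ S (S k)) with (rho * rho ^ S k) in *.
      lra. }
  assert (H1 := Hrec n).
  assert (H2 : 0 <= rho ^ S n * gap n)
    by (apply Rmult_le_pos; [apply pow_le; lra | apply Hgap]).
  assert (H3 : M n <= M (S n)).
  { unfold M. rewrite Rsum_S.
    assert (0 <= x (S n) ^ 2 * rho ^ S n)
      by (apply Rmult_le_pos; [apply pow2_ge_0 | apply pow_le; lra]).
    lra. }
  fold (M n). lra.
Qed.

(** Termwise, [rho ^ k] times [2 p b <= lambda p ^ 2 + b ^ 2 / lambda] with
    [p = x k] and [b = beta ^ k]. *)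
Lemma sum_le_weighted_squares (x : nat -> R) (lambda rho beta : R) (n : nat) :
  0 < lambda -> 0 <= rho ->
  2 * (sum_n (fun k => x k * (rho * beta) ^ k) n - x O)
  <= lambda * (sum_n (fun k => x k ^ 2 * rho ^ k) n - x O ^ 2)
     + / lambda * (sum_n (fun k => (rho * beta ^ 2) ^ k) n - 1).
Proof.
  intros Hl Hr. induction n as [|n IH].
  - rewrite !sum_O. simpl. right. ring.
  - rewrite !Rsum_S.
    assert (H : 2 * (x (S n) * (rho * beta) ^ S n)
      <= lambda * (x (S n) ^ 2 * rho ^ S n) + / lambda * (rho * beta ^ 2) ^ S n).
    { rewrite !Rpow_mult_distr, <- pow_mult, Nat.mul_comm, pow_mult.
      set (p := x (S n)). set (b := beta ^ S n).
      assert (Hu : 0 <= rho ^ S n) by (apply pow_le; lra).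
      set (u := rho ^ S n) in *.
      assert (E : lambda * (p ^ 2 * u) + / lambda * (u * b ^ 2) - 2 * (p * (u * b))
        = u * / lambda * (lambda * p - b) ^ 2) by (field; lra).
      assert (0 <= u * / lambda * (lambda * p - b) ^ 2).
      { apply Rmult_le_pos; [|apply pow2_ge_0].
        apply Rmult_le_pos; [lra|]. apply Rlt_le, Rinv_0_lt_compat. lra. }
      lra. }
    lra.
Qed.

(** For [x 0 < 1] the right-hand side is the majorant series of the automorphism
    [(x 0 - z) / (1 - x 0 * z)].  The parameters [rho = r / x 0], [beta = x 0] and
    [lambda = x 0 / (1 - x 0 ^ 2)] are those for which every inequality used becomes
    an equality for its coefficients as [n] grows; [rho <= 1] is where [r <= x 0]
    enters. *)
Lemma majorant_large_x0 (x : nat -> R) (r : R) (n : nat) :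
  0 < x O <= 1 -> 0 <= r <= x O -> r < 1 ->
  coefficient_condition x ->
  sum_n (fun k => x k * r ^ k) n <= x O + r * (1 - x O ^ 2) / (1 - x O * r).
Proof.
  intros Ha Hr Hr1 H.
  assert (H' := H). unfold coefficient_condition in H'.
  set (a := x O) in *.
  assert (Har : 0 <= a * r < 1) by nra.
  destruct (Req_dec a 1) as [Ha1|Ha1].
  - assert (Hz : forall k, x (S k) = 0).
    { intros k. specialize (H' k). rewrite Ha1 in H'. nra. }
    assert (E : sum_n (fun k => x k * r ^ k) n = a :> R).
    { induction n as [|n IH].
      - rewrite sum_O. simpl. unfold a. ring.
      - rewrite Rsum_S, IH, Hz. ring. }
    rewrite E, Ha1. right. field. nra.
  - set (d := 1 - a ^ 2) in *.
    assert (Hd : 0 < d) by (unfold d; nra).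
    assert (Hrho : 0 <= r / a <= 1).
    { split; [apply Rle_div_r; lra | apply Rle_div_l; lra]. }
    assert (HM := weighted_square_sum x (r / a) Hrho H n).
    assert (HS := sum_le_weighted_squares x (a / d) (r / a) a n
                    ltac:(apply Rdiv_lt_0_compat; lra) ltac:(lra)).
    fold a d in HM, HS.
    replace (a ^ 2 * (r / a)) with (a * r) in HM by (field; lra).
    replace (r / a * a) with r in HS by (field; lra).
    replace (r / a * a ^ 2) with (a * r) in HS by (field; lra).
    assert (HG := sum_geom_le (a * r) n Har).
    set (M := sum_n _ n - a ^ 2) in *.
    set (Sg := sum_n (fun k => (a * r) ^ k) n) in *.
    assert (HM' : M <= r / a * d ^ 2 / (1 - a * r)) by (apply Rle_div_r; lra).
    assert (H1 : a / d * M <= r * d / (1 - a * r)).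
    { replace (r * d / (1 - a * r)) with (a / d * (r / a * d ^ 2 / (1 - a * r)))
        by (field; lra).
      apply Rmult_le_compat_l; [apply Rle_div_r; lra | exact HM']. }
    assert (H2 : / (a / d) * (Sg - 1) <= r * d / (1 - a * r)).
    { replace (r * d / (1 - a * r)) with (/ (a / d) * (/ (1 - a * r) - 1))
        by (field; lra).
      apply Rmult_le_compat_l; [|lra].
      apply Rlt_le, Rinv_0_lt_compat, Rdiv_lt_0_compat; lra. }
    lra.
Qed.

(** Far from the extremal case a crude choice suffices: [rho = 1], and
    [lambda = 1 / 3] gives [(1 / 3 + 3 * (9 / 8 - 1)) / 2 = 17 / 48]. *)
Lemma majorant_small_x0 (x : nat -> R) (r : R) (n : nat) :
  0 <= x O <= 1 / 3 -> 0 <= r <= 1 / 3 ->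
  coefficient_condition x ->
  sum_n (fun k => x k * r ^ k) n <= x O + 17 / 48.
Proof.
  intros Ha Hr H.
  assert (HM := weighted_square_sum x 1 ltac:(lra) H n).
  assert (HS := sum_le_weighted_squares x (1 / 3) 1 r n ltac:(lra) ltac:(lra)).
  rewrite !Rmult_1_l in HS.
  assert (HG := sum_geom_le (r ^ 2) n ltac:(nra)).
  set (M := sum_n _ n - x O ^ 2) in *.
  assert (HM' : M <= 1 - x O ^ 2).
  { apply (Rmult_le_reg_l (1 - x O ^ 2)); [nra | lra]. }
  assert (HG' : / (1 - r ^ 2) <= 9 / 8).
  { apply Rle_trans with (/ (8 / 9)); [apply Rinv_le_contravar; nra | lra]. }
  replace (/ (1 / 3)) with 3 in HS by field.
  pose proof (pow2_ge_0 (x O)). lra.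
Qed.

(** The bound [B] of the tail of the majorant series also bounds [|f z - a 0|], so
    the whole inequality comes down to [x 0 + B + B ^ 2 <= 1]. *)
Lemma majorant_bound (x : nat -> R) (r : R) :
  0 <= x O <= 1 -> 0 <= r <= 1 / 3 ->
  coefficient_condition x ->
  exists B, 0 <= B /\ x O + B + B ^ 2 <= 1 /\
    forall n, sum_n (fun k => x k * r ^ k) n <= x O + B.
Proof.
  intros Ha Hr H.
  destruct (Rle_dec (x O) (1 / 3)) as [Hs|Hs].
  - exists (17 / 48). split; [lra|]. split; [nra|].
    intros n. apply majorant_small_x0; (exact H || lra).
  - pose (B := (1 - x O ^ 2) / (3 - x O)).
    exists B.
    assert (HB : 0 <= B) by (apply Rle_div_r; nra).
    split; [exact HB|]. split.
    (* The slack has order 3 at [x 0 = 1]: a bound of the tail that is not sharp to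
       second order there, such as the one from [x k <= 1 - x 0 ^ 2], would fail. *)
    + assert (E : 1 - (x O + B + B ^ 2)
        = (1 - x O) ^ 3 * (5 + x O) / (3 - x O) ^ 2) by (unfold B; field; lra).
      assert (0 <= (1 - x O) ^ 3 * (5 + x O) / (3 - x O) ^ 2).
      { apply Rle_div_r; [apply pow_lt; lra|]. rewrite Rmult_0_l.
        apply Rmult_le_pos; [apply pow_le|]; lra. }
      lra.
    + intros n. apply Rle_trans with (x O + r * (1 - x O ^ 2) / (1 - x O * r)).
      * apply majorant_large_x0; (exact H || lra).
      * apply Rplus_le_compat_l. apply Rle_div_l; [nra|]. unfold B.
        replace ((1 - x O ^ 2) / (3 - x O) * (1 - x O * r))
          with ((1 - x O ^ 2) * ((1 - x O * r) / (3 - x O))) by (field; lra).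
        rewrite Rmult_comm. apply Rmult_le_compat_l; [nra|].
        apply Rle_div_r; lra.
Qed.

Lemma bohr_inequality_one_third : bohr_inequality_up_to (1 / 3).
Proof.
  intros f a _ Hf Hb z r Hz Hzr Hr.
  assert (Hr0 : 0 <= r) by (rewrite <- Hzr; apply Cmod_ge_0).
  destruct (majorant_bound (fun k => Cmod (a k)) r) as [B [HB [HB1 HBn]]].
  { split; [apply Cmod_ge_0 | apply (bounded_coefficients f a Hf Hb)]. }
  { lra. }
  { apply (bounded_coefficients f a Hf Hb). }
  assert (Hincr : forall n, sum_n (fun k => Cmod (a k) * r ^ k) n
                         <= sum_n (fun k => Cmod (a k) * r ^ k) (S n)).
  { intros n. apply Rsum_mono; [|lia]. intros k.
    apply Rmult_le_pos; [apply Cmod_ge_0 | now apply pow_le]. }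
  destruct (ex_finite_lim_seq_incr _ _ Hincr HBn) as [s Hs].
  exists s. split; [exact Hs|].
  assert (Hsle : s <= Cmod (a O) + B).
  { exact (is_lim_seq_le _ _ s (Cmod (a O) + B) HBn Hs (is_lim_seq_const _)). }
  assert (Hfz : Cmod (f z - a O) <= B).
  { apply le_of_le_plus_small with 1; [lra|]. intros e He.
    destruct (poly_eval_cvg a z (f z) (Hf z Hz) e ltac:(lra)) as [N HN].
    specialize (HN N (le_n N)).
    pose proof (poly_eval_increment a z 0 N) as Hi.
    rewrite Hzr, Nat.add_0_l, !sum_O in Hi. specialize (HBn N).
    assert (E0 : poly_eval a 0 z = a O)
      by (unfold poly_eval; rewrite sum_O; simpl; apply Cmult_1_r).
    rewrite E0 in Hi. simpl (r ^ 0) in Hi.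
    replace (f z - a O)%C
      with ((poly_eval a N z - a O) + - (poly_eval a N z - f z))%C by ring.
    eapply Rle_trans; [apply Cmod_triangle|]. rewrite Cmod_opp. lra. }
  pose proof (Cmod_ge_0 (f z - a O)). nra.
Qed.

(** * Sharpness: the automorphisms of the disk *)

Lemma is_series_Cgeom (w : C) :
  Cmod w < 1 ->
  is_series (K := C_AbsRing) (V := C_NormedModule) (fun k => w ^ k)%C (/ (1 - w))%C.
Proof.
  intros Hw.
  assert (H1 : (1 - w)%C <> 0%C).
  { intros E. assert (w = 1%C) as E1.
    { replace w with (1 - (1 - w))%C by ring. rewrite E. ring. }
    rewrite E1, Cmod_1 in Hw. lra. }
  assert (Hp : 0 < Cmod (1 - w)) by now apply Cmod_gt_0.
  apply filterlim_locally_ball_norm. intros eps.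
  destruct (pow_lt_1_zero (Cmod w)) with (y := eps * Cmod (1 - w)) as [N HN].
  { rewrite Rabs_pos_eq; [exact Hw | apply Cmod_ge_0]. }
  { apply Rmult_lt_0_compat; [apply cond_pos | exact Hp]. }
  exists N. intros n Hn. specialize (HN (S n) ltac:(lia)).
  rewrite Rabs_pos_eq in HN by apply pow_le, Cmod_ge_0.
  change (Cmod (sum_n (fun k => w ^ k)%C n - / (1 - w)) < eps).
  replace (sum_n (fun k => w ^ k)%C n - / (1 - w))%C with (- (w ^ S n / (1 - w)))%C.
  - rewrite Cmod_opp, Cmod_div, Cmod_pow by exact H1.
    apply Rlt_div_l; lra.
  - replace (sum_n (fun k => w ^ k)%C n : C)
      with (((1 - w) * sum_n (fun k => w ^ k) n) / (1 - w))%C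
      by (field; exact H1).
    rewrite Csum_geom. field. exact H1.
Qed.

Definition blaschke (a : R) (z : C) : C := ((a - z) / (1 - a * z))%C.

Definition blaschke_coef (a : R) (k : nat) : C :=
  match k with O => RtoC a | S j => RtoC (- ((1 - a ^ 2) * a ^ j)) end.

Lemma Cmod_one_minus_ge (a : R) (z : C) :
  0 <= a < 1 -> Cmod z <= 1 -> 1 - a <= Cmod (1 - a * z).
Proof.
  intros Ha Hz.
  assert (H := Cmod_triangle (1 - a * z) (a * z)).
  replace (1 - a * z + a * z)%C with (1 : C) in H by ring.
  rewrite Cmod_1, Cmod_mult, Cmod_R, Rabs_pos_eq in H by lra. nra.
Qed.

Lemma one_minus_neq_0 (a : R) (z : C) :
  0 <= a < 1 -> Cmod z <= 1 -> (1 - a * z)%C <> 0%C.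
Proof.
  intros Ha Hz. apply Cmod_gt_0.
  pose proof (Cmod_one_minus_ge a z Ha Hz). lra.
Qed.

Lemma blaschke_power_series (a : R) :
  0 <= a < 1 -> has_power_series_on_disk (blaschke a) (blaschke_coef a).
Proof.
  intros Ha z Hz. unfold in_unit_disk in Hz.
  pose proof (one_minus_neq_0 a z Ha ltac:(lra)) as Hne.
  assert (Haz : Cmod (a * z) < 1).
  { rewrite Cmod_mult, Cmod_R, Rabs_pos_eq by lra. pose proof (Cmod_ge_0 z). nra. }
  apply is_series_decr_1.
  apply (is_series_ext (K := C_AbsRing) (V := C_NormedModule)
    (fun k => scal (K := C_AbsRing) (V := C_NormedModule)
       (- ((1 - a ^ 2) * z))%C ((a * z) ^ k)%C)).
  - intros k. change (@scal _ C_NormedModule) with Cmult.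
    change (@pow_n (AbsRing.Ring C_AbsRing)) with Cpow.
    change (blaschke_coef a (S k)) with (RtoC (- ((1 - a ^ 2) * a ^ k))).
    rewrite Cpow_mult_l, (Cpow_S z), RtoC_opp, RtoC_mult, RtoC_minus,
      !RtoC_pow.
    C_ring.
  - replace (plus _ _) with
      (scal (K := C_AbsRing) (V := C_NormedModule)
         (- ((1 - a ^ 2) * z))%C (/ (1 - a * z))%C).
    + apply (is_series_scal (K := C_AbsRing) (V := C_NormedModule)).
      now apply is_series_Cgeom.
    + change (@scal _ C_NormedModule) with Cmult.
      change (- ((1 - a ^ 2) * z) * / (1 - a * z)
              = blaschke a z + - (1 * RtoC a))%C.
      unfold blaschke. field. exact Hne.
Qed.

(** [|1 - a z| ^ 2 - |a - z| ^ 2 = (1 - a ^ 2) * (1 - |z| ^ 2)]. *)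
Lemma blaschke_bounded (a : R) :
  0 <= a < 1 -> bounded_by_one_on_disk (blaschke a).
Proof.
  intros Ha z Hz. unfold in_unit_disk in Hz. unfold blaschke.
  pose proof (one_minus_neq_0 a z Ha ltac:(lra)) as Hne.
  rewrite Cmod_div by exact Hne.
  apply Rle_div_l; [now apply Cmod_gt_0|]. rewrite Rmult_1_l.
  apply Rsqr_incr_0; try apply Cmod_ge_0.
  assert (Hz2 : Cmod z ^ 2 <= 1) by (pose proof (Cmod_ge_0 z); nra).
  rewrite !Rsqr_pow2. rewrite Cmod2_alt in *. rewrite Cmod2_alt.
  destruct z as [x y]. unfold Re, Im in *. simpl in *.
  assert (0 <= (1 - a * a) * (1 - (x * x + y * y))) by (apply Rmult_le_pos; nra).
  nra.
Qed.

(** The first-order remainder at [z] equals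
    [- a (1 - a ^ 2) (y - z) ^ 2 / ((1 - a z) ^ 2 (1 - a y))], and both denominators
    are at least [1 - a] in modulus. *)
Lemma blaschke_analytic (a : R) : 0 <= a < 1 -> analytic_on_disk (blaschke a).
Proof.
  intros Ha z Hz. unfold in_unit_disk in Hz.
  pose proof (one_minus_neq_0 a z Ha ltac:(lra)) as Hne.
  exists (- (1 - a ^ 2) / (1 - a * z) ^ 2)%C.
  split; [apply is_linear_scal_l|].
  intros x Hx. apply (is_filter_lim_locally_unique (V := AbsRing_NormedModule C_AbsRing)) in Hx.
  subst x.
  intros eps.
  assert (Hc : 0 < (1 - a) ^ 3) by (apply pow_lt; lra).
  assert (Hd : 0 < Rmin (1 - Cmod z) (eps * (1 - a) ^ 3)).
  { apply Rmin_glb_lt; [lra|]. apply Rmult_lt_0_compat; [apply cond_pos | exact Hc]. }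
  exists (mkposreal _ Hd). intros y Hy.
  change (Cmod (y - z) < Rmin (1 - Cmod z) (eps * (1 - a) ^ 3)) in Hy.
  change (Cmod (blaschke a y - blaschke a z
            - (y - z) * (- (1 - a ^ 2) / (1 - a * z) ^ 2))%C <= eps * Cmod (y - z)).
  assert (Hy1 := Rlt_le_trans _ _ _ Hy (Rmin_l _ _)).
  assert (Hy2 := Rlt_le_trans _ _ _ Hy (Rmin_r _ _)).
  assert (Hyd : Cmod y <= 1).
  { replace y with ((y - z) + z)%C by ring.
    eapply Rle_trans; [apply Cmod_triangle | lra]. }
  pose proof (one_minus_neq_0 a y Ha Hyd) as Hney.
  replace (blaschke a y - blaschke a z - (y - z) * (- (1 - a ^ 2) / (1 - a * z) ^ 2))%C
    with ((y - z) * ((y - z) * (RtoC (- (a * (1 - a ^ 2)))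
            / ((1 - a * z) ^ 2 * (1 - a * y)))))%C.
  2:{ unfold blaschke.
      rewrite RtoC_opp, RtoC_mult, RtoC_minus, RtoC_pow. field. split; assumption. }
  assert (Hden : ((1 - a * z) ^ 2 * (1 - a * y))%C <> 0%C).
  { apply Cmult_neq_0; [apply Cpow_nz|]; assumption. }
  rewrite !Cmod_mult, Cmod_div, Cmod_mult, Cmod_pow, Cmod_R, Rabs_Ropp by exact Hden.
  rewrite Rmult_comm. apply Rmult_le_compat_r; [apply Cmod_ge_0|].
  assert (Hz1 := Cmod_one_minus_ge a z Ha ltac:(lra)).
  assert (Hy3 := Cmod_one_minus_ge a y Ha Hyd).
  assert (Hk : 0 <= a * (1 - a ^ 2) <= 1) by nra.
  rewrite Rabs_pos_eq by lra.
  assert (Hq : (1 - a) ^ 3 <= Cmod (1 - a * z) ^ 2 * Cmod (1 - a * y)).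
  { change ((1 - a) ^ 3) with ((1 - a) ^ (2 + 1)). rewrite pow_add, pow_1.
    apply Rmult_le_compat; try lra; [apply pow_le; lra | apply pow_incr; lra]. }
  set (q := Cmod (1 - a * z) ^ 2 * Cmod (1 - a * y)) in *.
  unfold Rdiv. rewrite <- Rmult_assoc. apply Rle_div_l; [lra|].
  pose proof (Cmod_ge_0 (y - z)). pose proof (cond_pos eps).
  apply Rle_trans with (eps * (1 - a) ^ 3).
  - nra.
  - apply Rmult_le_compat_l; lra.
Qed.

Lemma blaschke_majorant (a r : R) :
  0 <= a < 1 -> 0 <= r < 1 ->
  is_series (fun k => Cmod (blaschke_coef a k) * r ^ k)
    (a + r * (1 - a ^ 2) / (1 - a * r)).
Proof.
  intros Ha Hr. assert (Har : 0 <= a * r < 1) by nra.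
  apply is_series_decr_1.
  apply (is_series_ext (fun k => scal (K := R_AbsRing) (V := R_NormedModule)
    (r * (1 - a ^ 2)) ((a * r) ^ k))).
  - intros k. change (@scal _ R_NormedModule) with Rmult.
    simpl blaschke_coef. rewrite Cmod_R, Rabs_Ropp, Rabs_pos_eq.
    + rewrite Rpow_mult_distr. simpl. ring.
    + apply Rmult_le_pos; [nra | apply pow_le; lra].
  - replace (plus _ _) with
      (scal (K := R_AbsRing) (V := R_NormedModule) (r * (1 - a ^ 2)) (/ (1 - a * r))).
    + apply (is_series_scal (K := R_AbsRing) (V := R_NormedModule)).
      apply is_series_geom. rewrite Rabs_pos_eq; lra.
    + simpl blaschke_coef. rewrite Cmod_R, Rabs_pos_eq by lra.
      change (r * (1 - a ^ 2) * / (1 - a * r)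
              = a + r * (1 - a ^ 2) / (1 - a * r) + - (a * 1)).
      field. lra.
Qed.

(** The majorant series of [blaschke a] exceeds [1] as soon as [r * (1 + 2 * a) > 1],
    which some [a < 1] satisfies when [r > 1 / 3]. *)
Lemma bohr_radius_sharp (rho : R) : 1 / 3 < rho -> ~ bohr_inequality_up_to rho.
Proof.
  intros Hrho HB.
  (* [rho] may exceed [1], whereas the test point must lie in the disk. *)
  pose (r := Rmin rho (1 / 2)).
  assert (Hr : 1 / 3 < r <= 1 / 2).
  { split; [apply Rmin_glb_lt; lra | apply Rmin_r]. }
  (* The midpoint of the solution [(1 / r - 1) / 2] of [r * (1 + 2 * a) = 1] and [1]. *)
  pose (a := (/ r + 1) / 4).
  assert (Hinv : 2 <= / r < 3).
  { split.
    - replace 2 with (/ (1 / 2)) by field. apply Rinv_le_contravar; lra.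
    - replace 3 with (/ (1 / 3)) by field. apply Rinv_lt_contravar; lra. }
  assert (Ha : 0 <= a < 1) by (unfold a; lra).
  destruct (HB (blaschke a) (blaschke_coef a)) with (z := RtoC r) (r := r)
    as [s [Hs Hle]].
  - now apply blaschke_analytic.
  - now apply blaschke_power_series.
  - now apply blaschke_bounded.
  - unfold in_unit_disk. rewrite Cmod_R, Rabs_pos_eq; lra.
  - rewrite Cmod_R, Rabs_pos_eq; lra.
  - apply Rmin_l.
  - apply is_series_unique in Hs.
    rewrite (is_series_unique _ _ (blaschke_majorant a r Ha ltac:(lra))) in Hs.
    assert (Hsq := pow2_ge_0 (Cmod (blaschke a r - blaschke_coef a 0))).
    assert (Hgain : 1 < r * (1 + 2 * a)).
    { unfold a. replace (r * (1 + 2 * ((/ r + 1) / 4))) with (3 / 2 * r + 1 / 2)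
        by (field; lra). lra. }
    assert (Har : 0 < 1 - a * r) by nra.
    assert (E : a + r * (1 - a ^ 2) / (1 - a * r) - 1
      = (1 - a) * (r * (1 + 2 * a) - 1) / (1 - a * r)) by (field; lra).
    assert (0 < (1 - a) * (r * (1 + 2 * a) - 1) / (1 - a * r)).
    { apply Rdiv_lt_0_compat; [apply Rmult_lt_0_compat|]; lra. }
    lra.
Qed.

Theorem theorem5 :
  bohr_inequality_up_to (1 / 3) /\
  (forall rho : R, 1 / 3 < rho -> ~ bohr_inequality_up_to rho).
Proof.
  split; [exact bohr_inequality_one_third | exact bohr_radius_sharp].
Qed.
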